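(* Let $G$ be a graph. Then there exists a one-to-one correspondence between the set of all smooth travel groupoids on $G$ and the set of all smooth T-partition systems on $G$.
   Context: Graphs are undirected, possibly infinite, with no loops and no multiple edges; write $G=(V,E)$. A travel groupoid is a nonempty set $V$ with binary operation $*$ satisfying (t1) $(u*v)*u=u$ for all $u,v$ and (t2) if $(u*v)*v=u$ then $u=v$; it is on $G$ if $V(G)=V$ and $E(G)=\{\{u,v\}\mid u\neq v,\ u*v=v\}$; it is smooth if for all $u,v,w$, $u*v=u*w$ implies $u*(v*w)=u*v$. For $u\in V$, $N_G[u]=\{u\}\cup\{v\mid\{u,v\}\in E\}$. A T-partition system on $G$ is a family $(V_{u,v}\subseteq V\mid (u,v)\in V\times V)$ such that: (P0) for every $u$, $\{V_{u,v}\mid v\in N_G[u]\}$ is a partition of $V$; (P1a) $V_{u,u}=\{u\}$; (P1b) for $u\neq v$: $v\in V_{u,v}$ iff $\{u,v\}\in E$; (P1c) for $u\neq v$: $V_{u,v}=\emptyset$ iff $\{u,v\}\notin E$; (P2) for $u\neq v$: $V_{u,v}\cap V_{v,u}=\emptyset$. It is smooth if (R4): for all $u,v,x,y,z\in V$, if $x,y\in V_{u,v}$ and $x\in V_{y,z}$ then $z\in V_{u,v}$. *)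

(* Defs.v *)
From mathcomp Require Import all_boot all_classical.

Set Implicit Arguments.
Unset Strict Implicit.
Unset Printing Implicit Defensive.

Local Open Scope classical_set_scope.

(* Simple undirected, possibly infinite graph with vertex set the whole of [V].
   As usual the vertex set is nonempty; this is needed, since on the empty
   vertex set there is a T-partition system but no travel groupoid. *)
Record graph (V : Type) := Graph {
  edges : set (set V);
  edges_pairs : forall e, edges e -> exists u v, u <> v /\ e = [set u; v];
  vertices_nonempty : [set: V] !=set0
}.

Definition closed_nbhd (V : Type) (G : graph V) (u : V) : set V :=
  [set u] `|` [set v | edges G [set u; v]].

Definition travel_groupoid (V : Type) (op : V -> V -> V) : Prop :=
  [/\ [set: V] !=set0,
      forall u v, op (op u v) u = u
    & forall u v, op (op u v) v = u -> u = v].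

Definition groupoid_on (V : Type) (G : graph V) (op : V -> V -> V) : Prop :=
  edges G = [set e | exists u v, [/\ e = [set u; v], u <> v & op u v = v]].

Definition smooth_groupoid (V : Type) (op : V -> V -> V) : Prop :=
  forall u v w, op u v = op u w -> op u (op v w) = op u v.

Definition smooth_travel_groupoids (V : Type) (G : graph V) :
    set (V -> V -> V) :=
  [set op | [/\ travel_groupoid op, groupoid_on G op & smooth_groupoid op]].

(* [partition] is indexed: W u v and W u v' are disjoint for distinct v and v'
   in N[u], rather than merely disjoint or equal. *)
Record T_partition_system (V : Type) (G : graph V) (W : V -> V -> set V) :
    Prop := {
  TP_P0 : forall u, partition (closed_nbhd G u) (W u) [set: V];
  TP_P1a : forall u, W u u = [set u];
  TP_P1b : forall u v, u <> v -> (W u v v <-> edges G [set u; v]);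
  TP_P1c : forall u v, u <> v -> (W u v = set0 <-> ~ edges G [set u; v]);
  TP_P2 : forall u v, u <> v -> W u v `&` W v u = set0
}.

Definition smooth_system (V : Type) (W : V -> V -> set V) : Prop :=
  forall u v x y z, W u v x -> W u v y -> W y z x -> W u v z.

Definition smooth_T_partition_systems (V : Type) (G : graph V) :
    set (V -> V -> set V) :=
  [set W | T_partition_system G W /\ smooth_system W].

(* Main.v *)
Require Import Defs.
From mathcomp Require Import all_boot all_classical.

(**
  A groupoid [op] and a system [W] correspond when [W u v] is the set of [w]
  with [u * w = v]: the partition axiom (P0) says exactly that such a relation
  is the graph of a function [w |-> u * w], and (R4) is then the smoothness
  condition read through this dictionary.
*)

Local Open Scope classical_set_scope.

Definition fibers {V : Type} (op : V -> V -> V) (u v : V) : set V :=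
  [set w | op u w = v].

Lemma fibers_inj {V : Type} : injective (@fibers V).
Proof.
move=> op op' e; apply/funext => u; apply/funext => w.
have : fibers op u (op u w) w by [].
by rewrite e /fibers /= => ->.
Qed.

Section TravelGroupoid.
Context {V : Type} {op : V -> V -> V}.
Context (tg : travel_groupoid op).

Lemma travel_back u v : op (op u v) u = u. Proof. by case: tg. Qed.

Lemma travel_eq {u v} : op (op u v) v = u -> u = v.
Proof. by case: tg => _ _; apply. Qed.

Lemma travel_id u : op u u = u.
Proof. by apply: travel_eq; rewrite travel_back. Qed.

(** (t1) for the pair [u * v], [u], whose inner product [(u * v) * u] is [u] by (t1) again. Thus
    every value [u * v] other than [u] is a neighbour of [u]. *)
Lemma travel_step u v : op u (op u v) = op u v.
Proof. by have := travel_back (op u v) u; rewrite (travel_back u v). Qed.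

Lemma travel_fix {u w} : op u w = u -> w = u.
Proof. by move=> e; apply/esym/travel_eq; rewrite !e. Qed.

End TravelGroupoid.

Lemma groupoid_on_edge {V : Type} {G : graph V} {op : V -> V -> V} :
  travel_groupoid op -> groupoid_on G op ->
  forall u v, u <> v -> (edges G [set u; v] <-> op u v = v).
Proof.
move=> tg -> u v uv; split => [[a [b [e ab abE]]]|uvE]; last by exists u, v.
have [ua|ub] : [set a; b] u by rewrite -e; left.
all: have [va|vb] : [set a; b] v by rewrite -e; right.
- by case: uv; rewrite ua va.
- by rewrite ua vb.
(* The edge is witnessed in the opposite direction, [v * u = u]; (t1) turns this into
   [u * v = v]. *)
- by rewrite ub va -[in LHS]abE (travel_back tg).
- by case: uv; rewrite ub vb.
Qed.

Lemma fibers_T_partition_system {V : Type} {G : graph V} (op : V -> V -> V) :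
  travel_groupoid op -> groupoid_on G op -> T_partition_system G (fibers op).
Proof.
move=> tg on.
have edgeP := groupoid_on_edge tg on.
have nonempty u v w : u <> v -> op u w = v -> edges G [set u; v].
  by move=> uv e; rewrite -e in uv *; apply/edgeP => //; exact: travel_step.
split.
- move=> u; split.
  + apply/seteqP; split => // w _; exists (op u w) => //.
    have [<-|uw] := pselect (u = op u w); first by left.
    by right; apply: (nonempty u _ w).
  + by move=> i j _ _ [w [<- <-]].
  + move=> v nv; exists v; rewrite /fibers /=.
    have [<-|uv] := pselect (u = v); first exact: travel_id.
    by apply/edgeP => //; case: nv => // vu; case: uv.
- move=> u; apply/seteqP; split => [w /= /(travel_fix tg) //|w /= ->].
  exact: travel_id.
- by move=> u v uv; split=> /edgeP; apply.
- move=> u v uv; split => [v0 /(edgeP _ _ uv) e|ne].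
    by have : fibers op u v v by []; rewrite v0.
  by apply/seteqP; split => // w /(nonempty _ _ _ uv).
(* A common point [x] gives [(u * x) * x = u], so [u = x] by (t2), and then [v = u * u = u]. *)
- move=> u v uv; apply/seteqP; split => // x [/= ux vx]; case: uv.
  have e : u = x by apply: (travel_eq tg); rewrite ux.
  by rewrite -ux -e (travel_id tg).
Qed.

(** For fibers the premises of (R4) force [v = u * x = u * y] and [z = y * x], leaving only [u],
    [x], [y] free. *)
Lemma fibers_smooth {V : Type} (op : V -> V -> V) :
  smooth_system (fibers op) <-> smooth_groupoid op.
Proof.
split => [sm u v w e|sm u v x y z /= <- yE <-].
  by apply: (sm u (op u v) w v (op v w)).
by rewrite /fibers /= sm.
Qed.

Lemma T_partition_fibers {V : Type} {G : graph V} {W : V -> V -> set V} :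
  T_partition_system G W -> exists op, fibers op = W.
Proof.
move=> [P0 P1a P1b P1c P2].
(* (P0) gives disjointness only for indices in the closed neighbourhood; (P1c) confines every
   nonempty block there, so the block containing [w] has a unique index. *)
have nbhd u v w : W u v w -> closed_nbhd G u v.
  move=> h; have [->|uv] := pselect (u = v); first by left.
  by right; apply: contrapT => /(P1c _ _ uv) W0; rewrite W0 in h.
have /choice [op opP] : forall p : V * V, exists v, W p.1 v p.2.
  move=> [u w]; have [cov _ _] := P0 u.
  have : [set: V] w by [].
  by rewrite -cov => -[v _ ?]; exists v.
exists (fun u w => op (u, w)); apply/funext => u; apply/funext => v.
apply/seteqP; split => w /= h; first by rewrite -h; exact: (opP (u, w)).
have [_ triv _] := P0 u; have h' := opP (u, w).
by apply: triv (nbhd _ _ _ h') (nbhd _ _ _ h) _; exists w.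
Qed.

Lemma fibers_travel_groupoid {V : Type} {G : graph V} {op : V -> V -> V} :
  T_partition_system G (fibers op) -> travel_groupoid op /\ groupoid_on G op.
Proof.
move=> [_ P1a P1b P1c P2].
have opuu u : op u u = u by change (fibers op u u u); rewrite P1a.
have edge u v : u <> v -> op u v = v <-> edges G [set u; v] by exact: P1b.
split.
  split; first exact: vertices_nonempty G.
  - move=> u v; have [e|ne] := pselect (u = op u v); first by rewrite -e.
    (* (t1) says that the edge between [u] and [u * v] can be read from its other end; that edge
       exists by (P1c), as [v] lies in the fiber over [u * v]. *)
    apply/edge; first by move=> e; apply: ne; rewrite e.
    rewrite setUC; apply: contrapT => /(P1c _ _ ne) W0.
    by have : fibers op u (op u v) v by []; rewrite W0.
  (* If [u * v = u], then (P1a) gives [v = u]; otherwise [v] lies in two fibers that (P2) makes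
     disjoint. *)
  - move=> u v e; have [e'|ne] := pselect (u = op u v).
      have : fibers op u u v by rewrite /fibers /= -e'.
      by rewrite P1a.
    by have : (fibers op u (op u v) `&` fibers op (op u v) u) v by []; rewrite P2.
apply/seteqP; split => [e eG|_ [u [v [-> uv uvE]]]]; last exact/edge.
have [u [v [uv eE]]] := edges_pairs eG.
by exists u, v; split=> //; apply/edge; rewrite -?eE.
Qed.

Theorem theorem4p10 (V : Type) (G : graph V) :
  exists f : (V -> V -> V) -> (V -> V -> set V),
    set_bij (smooth_travel_groupoids G) (smooth_T_partition_systems G) f.
Proof.
exists fibers; split.
- move=> op [tg on sm]; split; first exact: fibers_T_partition_system.
  exact/fibers_smooth.
- by move=> op op' _ _; apply: fibers_inj.
- move=> W [TP sm]; have [op opW] := T_partition_fibers TP.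
  rewrite -opW in TP sm; have [tg on] := fibers_travel_groupoid TP.
  by exists op => //; split=> //; apply/fibers_smooth.
Qed.
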